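(* Let $\mathbf{K}$ be a pure simplicial complex of dimension $d$ satisfying the hereditary removal-collapsibility (HRC) condition. Then the second barycentric subdivision $\mathrm{sd}^2\,\mathbf{K}=\mathrm{sd}(\mathrm{sd}\,\mathbf{K})$ is shellable.
   Context: Simplicial complexes are finite abstract simplicial complexes: finite set systems closed under taking subsets. A face with $k+1$ elements has dimension $k$; $\emptyset$ is a face of dimension $-1$ of every complex other than the void complex. The void complex $\emptyset$ (no faces, dimension $-\infty$) is distinguished from $\{\emptyset\}$ (dimension $-1$); a complex of dimension $d$ has $d\ge -1$. A facet is an inclusion-wise maximal face; a complex is pure if all its facets have the same dimension. The link of a face $\sigma\in\mathbf{K}$ is $\mathrm{lk}(\sigma,\mathbf{K})=\{\sigma'\setminus\sigma:\ \sigma'\in\mathbf{K},\ \sigma\subseteq\sigma'\}$; in particular $\mathrm{lk}(\emptyset,\mathbf{K})=\mathbf{K}$. The barycentric subdivision is $\mathrm{sd}\,\mathbf{K}=\{\{\sigma_1,\dots,\sigma_n\}:\ n\ge 0,\ \sigma_i\in\mathbf{K},\ \emptyset\ne\sigma_1\subsetneq\cdots\subsetneq\sigma_n\}$. Collapsibility: if a nonempty face $\sigma\in\mathbf{K}$ is properly contained in exactly one face $\tau$ of $\mathbf{K}$, then $\mathbf{K}\setminus\{\sigma,\tau\}$ arises from $\mathbf{K}$ by an elementary collapse. $\mathbf{K}$ is collapsible if some (possibly empty) sequence of elementary collapses reduces it to a point (a complex $\{\emptyset,\{v\}\}$). (RC) condition: a pure complex $\mathbf{K}$ satisfies the removal-collapsibility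 condition (RC) if either $\mathbf{K}$ is empty (meaning it has no vertices, i.e. $\mathbf{K}=\emptyset$ or $\mathbf{K}=\{\emptyset\}$), or there is a (possibly empty) set of facets $\phi_1,\dots,\phi_t$ of $\mathbf{K}$ such that $\mathbf{K}\setminus\{\phi_1,\dots,\phi_t\}$ (only the faces $\phi_i$ themselves are deleted) is collapsible. (HRC) condition: a pure complex $\mathbf{K}$ satisfies the hereditary removal-collapsibility condition (HRC) if $\mathrm{lk}(\sigma,\mathbf{K})$ satisfies (RC) for every face $\sigma\in\mathbf{K}$, including $\sigma=\emptyset$. Shellability: a pure complex of dimension $k$ is shellable if its facets admit a total order $F_1,\dots,F_t$ such that for every $i\ge 2$ the complex $F_i\cap\bigcup_{j=1}^{i-1}F_j$ is pure of dimension $k-1$, where each facet is regarded as the subcomplex of all its subsets. *)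

(* Defs.v *)
From mathcomp Require Import all_boot all_order all_algebra.

Set Implicit Arguments.
Unset Strict Implicit.
Unset Printing Implicit Defensive.

Import Order.TTheory GRing.Theory Num.Theory.
Local Open Scope ring_scope.

(* A finite simplicial complex is a set of subsets of a finite type T, closed *)
(* under taking subsets. An element of T need not be a vertex of the complex. *)
(* The void complex set0 and the complex [set set0] are both allowed.         *)

Section SimplicialComplexes.

Variable T : finType.
Implicit Types (K L : {set {set T}}) (s t F : {set T}).

Definition is_complex K : Prop :=
  forall s t, s \in K -> t \subset s -> t \in K.

Definition face_dim s : int := #|s|%:Z - 1.

(* A relation, so that the void complex has no dimension. *)
Definition has_dim K (d : int) : Prop :=
  (exists2 s, s \in K & face_dim s = d) /\
  (forall s, s \in K -> face_dim s <= d).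

Definition facets K : {set {set T}} :=
  [set F | maxset (fun s => s \in K) F].

Definition pure K : Prop :=
  forall F G, F \in facets K -> G \in facets K -> face_dim F = face_dim G.

Definition pure_of_dim K (d : int) : Prop := pure K /\ has_dim K d.

Definition link s K : {set {set T}} :=
  [set s' :\: s | s' in K & s \subset s'].

(* Chains are given as sets of pairwise comparable faces; see sdP for the     *)
(* presentation as strictly increasing sequences.                             *)
Definition sd K : {set {set {set T}}} :=
  [set C : {set {set T}} |
    [&& C \subset K, set0 \notin C &
        [forall s in C, forall t in C, (s \subset t) || (t \subset s)]]].

Definition elementary_collapse K L : Prop :=
  exists s t, [/\ s \in K, s != set0,
                  [set t' in K | s \proper t'] = [set t] &
                  L = K :\: [set s; t]].

Inductive collapsible : {set {set T}} -> Prop :=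
| collapsible_point v : collapsible [set set0; [set v]]
| collapsible_step K L :
    elementary_collapse K L -> collapsible L -> collapsible K.

Definition RC K : Prop :=
  [\/ K = set0, K = [set set0] |
      exists2 Phi : {set {set T}},
        Phi \subset facets K & collapsible (K :\: Phi)].

Definition HRC K : Prop := forall s, s \in K -> RC (link s K).

(* The sequence Fs is indexed from 0, so that the first facet is excluded     *)
(* from the condition; powerset F is the facet F viewed as a subcomplex.      *)
Definition is_shelling K (k : int) (Fs : seq {set T}) : Prop :=
  [/\ uniq Fs, Fs =i facets K &
      forall i, (0 < i < size Fs)%N ->
        pure_of_dim
          (powerset (nth set0 Fs i) :&:
           \bigcup_(j < i) powerset (nth set0 Fs j)) (k - 1)].

Definition shellable K : Prop :=
  exists2 k : int, pure_of_dim K k & exists Fs, is_shelling K k Fs.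

Lemma sdP K (C : {set {set T}}) :
  reflect (exists ss : seq {set T},
             [/\ path (fun s t => s \proper t) set0 ss,
                 {subset ss <= K} & C = [set:: ss]])
          (C \in sd K).
Proof.
have trP : transitive (fun s t : {set T} => s \proper t).
  by move=> y x z; exact: proper_trans.
apply: (iffP idP) => [|[ss [pss ssK ->]]]; last first.
  rewrite inE; have := pss; rewrite path_sortedE // => /andP[/allP ss0 srt].
  apply/and3P; split; first by apply/subsetP=> s; rewrite inE => /ssK.
    by apply/negP; rewrite inE => /ss0; rewrite properxx.
  apply/forall_inP=> s; rewrite inE => sin; apply/forall_inP=> t.
  rewrite inE => tin; move: srt; rewrite sorted_pairwise // => /(pairwiseP set0) pw.
  have si : (index s ss < size ss)%N by rewrite index_mem.
  have ti : (index t ss < size ss)%N by rewrite index_mem.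
  have [lt|lt|e] := ltngtP (index s ss) (index t ss).
  - by have := pw _ _ si ti lt; rewrite !nth_index // => /proper_sub ->.
  - by have := pw _ _ ti si lt; rewrite !nth_index // => /proper_sub ->; rewrite orbT.
  - by rewrite -(nth_index set0 sin) e nth_index // subxx.
rewrite inE => /and3P[/subsetP CK C0 /forall_inP ch].
pose le := fun s t : {set T} => s \subset t.
exists (sort le (enum C)); split.
- rewrite path_sortedE //; apply/andP; split.
    apply/allP=> s; rewrite mem_sort mem_enum => sC.
    by rewrite proper0; apply: contraNneq C0 => <-.
  have srt : sorted le (sort le (enum C)).
    apply: (sort_sorted_in (P := mem C)); last by apply/allP=> s; rewrite mem_enum.
    by move=> s t sC tC; have /forall_inP := ch s sC; apply.
  have un : uniq (sort le (enum C)) by rewrite sort_uniq enum_uniq.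
  have letr : transitive le by move=> y x z; exact: subset_trans.
  rewrite sorted_pairwise //; rewrite sorted_pairwise // in srt.
  rewrite uniq_pairwise in un.
  have := conj srt un; move/andP; rewrite -pairwise_relI.
  by apply: sub_pairwise => s t /andP[st /= ne]; rewrite properEneq ne.
- by move=> s; rewrite mem_sort mem_enum => /CK.
- by apply/setP=> s; rewrite inE mem_sort mem_enum.
Qed.

End SimplicialComplexes.

(* Main.v *)
Require Import Defs.
From mathcomp Require Import all_boot all_order all_algebra.

Set Implicit Arguments.
Unset Strict Implicit.
Unset Printing Implicit Defensive.

(* Write a facet of sd (sd K) as an enumeration x_1, ..., x_n of a maximal chain of nonempty faces of K:
   its vertices are the sets {x_1, ..., x_i}. Order these enumerations by x_1, and for fixed x_1 = x
   recursively in the link of x in sd K. This is a shelling as soon as the nonempty faces of K are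
   ordered so that the recursive order on each link can start with the enumerations whose first entry
   is an earlier face, that is, with a regular neighbourhood of the earlier vertices of the link. By
   recursion it suffices that the earlier vertices span, up to homotopy, nothing, a ball, or the whole
   link; links in sd K are joins of subdivided boundaries of simplices and of a subdivided link of K,
   and the condition passes to joins.

   For K satisfying (HRC) the order is: the final point of the collapse; then, undoing the elementary
   collapses one by one, the larger face t of each pair followed by the smaller face s; finally the
   removed facets. When t comes, the earlier part of its link is its boundary without s, a ball; when s
   comes, it is the whole boundary of s joined with the single point t, and one uses that a collapse
   can be made to end at any prescribed vertex; for a removed facet it is the whole boundary. *)

(** * Facets and purity *)

Section Facets.
Variable T : finType.
Implicit Types (K : {set {set T}}) (s t F G : {set T}).

Lemma facets_maximal K s t : s \in facets K -> t \in K -> s \subset t -> s = t.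
Proof. by rewrite inE => /maxsetP[_ max] tK /(max t tK) ->. Qed.

Lemma pure_card K F G : pure K -> F \in facets K -> G \in facets K -> #|F| = #|G|.
Proof. by move=> pK FK GK; have /GRing.addIr[] := pK F G FK GK. Qed.

Lemma facet_ex K s : s \in K -> exists2 F, F \in facets K & s \subset F.
Proof. by move/maxset_exists=> [F mF sF]; exists F; rewrite ?inE. Qed.

Lemma pure_of_dim_card K (m : nat) :
  (exists s, s \in K) ->
  (forall s, s \in K -> exists2 F : {set T}, s \subset F & F \in K /\ #|F| = m) ->
  pure_of_dim K (m%:Z - 1)%R.
Proof.
move=> [s sK] H; have card_F F : F \in facets K -> #|F| = m.
  move=> FK; have FK' : F \in K by move: FK; rewrite inE => /maxsetP[].
  by have [G FG [GK <-]] := H F FK'; rewrite (facets_maximal FK GK FG).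
split; first by move=> F G /card_F cF /card_F cG; rewrite /face_dim cF cG.
split; first by have [F _ [FK <-]] := H s sK; exists F.
move=> t /H[F tF [_ <-]]; rewrite /face_dim Num.Theory.lerD2r.
by rewrite ssrint.lez_nat subset_leq_card.
Qed.

End Facets.

(** * Clique complexes and vertex orders *)

Section CliqueComplexes.
Variables (U : finType) (e : rel U).
Hypotheses (e_sym : symmetric e) (e_irr : irreflexive e).
Implicit Types (Q A B P : {set U}) (x y u v : U) (s t r : seq U) (L : seq (seq U))
  (R : {set U} -> {set U} -> Prop).

(* The vertices of the link of [x] in the complex of cliques of [e] contained in [Q]. *)
Definition nb Q x := [set y in Q | e x y].

(** [R] constrains the link of each new vertex together with the part of it already present. Keeping
    [R] a parameter lets [ball] recurse through [steps] on smaller links. *)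
Inductive steps R Q : {set U} -> {set U} -> Prop :=
| steps0 A : steps R Q A A
| stepsS x A A' : x \in Q -> x \notin A -> R (nb Q x) (A :&: nb Q x) ->
    steps R Q (x |: A) A' -> steps R Q A A'.

(* [Q] has a vertex order with initial segment [A] in which the earlier part of the link of a vertex is
   empty for the first vertex, a [ball] for the others in [A], and a [ball] or the full link afterwards.
   The disjunctions are [good (nb Q x)] and [ball_or_full P B] below. *)
Inductive ball Q A : Prop := Ball x of x \in Q
  & nb Q x = set0 \/ (exists B, ball (nb Q x) B)
  & steps ball Q [set x] A
  & steps (fun P B => ball P B \/ (P = set0 \/ (exists C, ball P C)) /\ B = P) Q A Q.

Definition good Q := Q = set0 \/ exists A, ball Q A.
Definition ball_or_full P B := ball P B \/ good P /\ B = P.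

Lemma nb_sub Q x : nb Q x \subset Q.
Proof. by apply/subsetP=> y; rewrite inE => /andP[]. Qed.

Lemma card_nb Q x : x \in Q -> #|nb Q x| < #|Q|.
Proof.
move=> xQ; apply: proper_card; rewrite properE nb_sub /=.
by apply/subsetPn; exists x => //; rewrite inE e_irr andbF.
Qed.

Lemma nbU Q P x : nb (Q :|: P) x = nb Q x :|: nb P x.
Proof. by apply/setP=> y; rewrite !inE andb_orl. Qed.

Lemma steps_trans R Q A B C : steps R Q A B -> steps R Q B C -> steps R Q A C.
Proof. by elim=> // x A1 A2 xQ xA Rx _ IH /IH; apply: stepsS. Qed.

Lemma steps1 R Q A x : x \in Q -> x \notin A -> R (nb Q x) (A :&: nb Q x) ->
  steps R Q A (x |: A).
Proof. by move=> xQ xA Rx; apply: (stepsS xQ xA Rx); apply: steps0. Qed.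

Lemma steps_mono R R' Q A B : (forall P C, R P C -> R' P C) ->
  steps R Q A B -> steps R' Q A B.
Proof. by move=> RR'; elim=> [C|x C D xQ xC /RR' Rx _]; [apply: steps0|apply: stepsS]. Qed.

Lemma steps_sub R Q A B : steps R Q A B -> A \subset B.
Proof. by elim=> // x C D xQ xC _ _; apply: subset_trans; apply: subsetUr. Qed.

Lemma steps_subr R Q A B : steps R Q A B -> A \subset Q -> B \subset Q.
Proof. by elim=> // x C D xQ xC _ _ IH CQ; apply: IH; rewrite subUset sub1set xQ. Qed.

Lemma steps_all R Q A : A \subset Q ->
  (forall x B, x \in Q -> x \notin A -> A \subset B -> R (nb Q x) (B :&: nb Q x)) ->
  steps R Q A Q.
Proof.
move=> AQ RA; suff: forall B, B \subset Q -> A \subset B -> steps R Q B Q by apply.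
move=> B; have [n] := ubnP #|Q :\: B|; elim: n B => // n IH B.
case: (set_0Vmem (Q :\: B)) => [QB0 _ BQ AB|[x]].
  suff <- : B = Q by apply: steps0.
  by apply/eqP; rewrite eqEsubset BQ -setD_eq0 QB0 eqxx.
rewrite inE => /andP[xB xQ] lt BQ AB.
have xA : x \notin A by apply: contra xB; apply: (subsetP AB).
apply: (stepsS xQ xB); first exact: RA.
apply: IH.
- rewrite -ltnS; apply: leq_trans lt; rewrite ltnS; apply/proper_card/properP.
  by split; [apply: setDS; apply: subsetUr | exists x; rewrite !inE ?eqxx ?xB].
- by rewrite subUset sub1set xQ.
- by apply: subset_trans AB _; apply: subsetUr.
Qed.

(** * Joins of vertex orders *)

Definition joined Q P := forall x y, x \in Q -> y \in P -> e x y.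

Lemma joinedC Q P : joined Q P -> joined P Q.
Proof. by move=> j x y xP yQ; rewrite e_sym; apply: j. Qed.

Lemma joined_disj Q P x : joined Q P -> x \in Q -> x \notin P.
Proof. by move=> j xQ; apply/negP=> xP; have := j x x xQ xP; rewrite e_irr. Qed.

Lemma joined_nb Q P x : joined Q P -> joined (nb Q x) P.
Proof. by move=> j u v /(subsetP (nb_sub Q x)); apply: j. Qed.

Lemma nb_join Q P x : joined Q P -> x \in Q -> nb (Q :|: P) x = nb Q x :|: P.
Proof.
move=> j xQ; rewrite nbU; congr (_ :|: _); apply/setP=> y.
by rewrite inE; case: (boolP (y \in P)) => //= yP; rewrite j.
Qed.

Lemma steps_join R R' Q P A A' B : joined Q P -> A \subset Q -> B \subset P ->
  (forall x (C : {set U}), x \in Q -> C \subset nb Q x -> R (nb Q x) C ->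
    R' (nb Q x :|: P) (C :|: B)) ->
  steps R Q A A' -> steps R' (Q :|: P) (A :|: B) (A' :|: B).
Proof.
move=> j AQ BP RR' st; elim: st AQ => [C _|x C D xQ xC Rx _ IH CQ]; first exact: steps0.
have xP := joined_disj j xQ.
apply: (@stepsS _ _ x).
- by rewrite inE xQ.
- by rewrite inE negb_or xC; apply: contra xP; apply: (subsetP BP).
- rewrite nb_join //.
  have -> : (C :|: B) :&: (nb Q x :|: P) = (C :&: nb Q x) :|: B.
    apply/setP=> y; rewrite !inE.
    case yB: (y \in B); first by rewrite (subsetP BP) // !orbT.
    rewrite !orbF; case yC: (y \in C) => //=.
    rewrite (subsetP CQ _ yC) /=; case yP: (y \in P); last by rewrite orbF.
    by have := joined_disj j (subsetP CQ _ yC); rewrite yP.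
  by apply: RR' => //; apply: subsetIr.
- by rewrite setUA; apply: IH; rewrite subUset sub1set xQ.
Qed.

Lemma ball_sub Q A : ball Q A -> A \subset Q.
Proof. by case=> x xQ _ st _; apply: (steps_subr st); rewrite sub1set. Qed.

(* The empty and the full part must not be joined with each other, hence these are only used against
   a [ball]. *)
Definition compat P B := [\/ good P /\ B = set0, ball P B | good P /\ B = P].

(** The order begins with [A], so that vertices of [P] added next meet the ball [A]. If [B] is empty
    or full, all of [P] follows, then the rest of [Q]; if [B] is a ball, [B] follows, then the rest
    of [Q], then that of [P]. The links met are smaller joins, whence the induction on
    [#|Q| + #|P|]. *)
Lemma ball_join Q P A B : joined Q P -> ball Q A -> compat P B -> ball (Q :|: P) (A :|: B).
Proof.
have [n] := ubnP (#|Q| + #|P|); elim: n Q P A B => // n IH Q P A B lt j bQ cP.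
have IHx x C D : x \in Q -> ball (nb Q x) C -> compat P D ->
    ball (nb Q x :|: P) (C :|: D).
  move=> xQ; apply: IH; last exact: joined_nb.
  by rewrite -ltnS; apply: leq_trans lt; rewrite ltnS ltn_add2r card_nb.
have IHx' x C D : x \in Q -> compat (nb Q x) C -> ball P D ->
    ball (nb Q x :|: P) (C :|: D).
  move=> xQ cx bP; rewrite setUC [C :|: D]setUC; apply: IH => //; last exact/joinedC/joined_nb.
  by rewrite -ltnS; apply: leq_trans lt; rewrite ltnS addnC ltn_add2r card_nb.
have IHy y C D : y \in P -> compat (nb P y) D -> ball Q C ->
    ball (nb P y :|: Q) (D :|: C).
  move=> yP cy bC; rewrite setUC [D :|: C]setUC; apply: IH => //;
    last exact/joinedC/joined_nb/joinedC.
  by rewrite -ltnS; apply: leq_trans lt; rewrite ltnS ltn_add2l card_nb.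
have g0x x : x \in Q -> good (nb Q x) -> good P -> good (nb Q x :|: P).
  move=> xQ [-> gP|[C bC] gP]; first by rewrite set0U.
  by right; exists (C :|: set0); apply: IHx => //; constructor 1.
have g0y y : y \in P -> good (nb P y) -> good Q -> good (nb P y :|: Q).
  move=> yP gy [->|[C bC]]; first by rewrite setU0.
  by right; exists (set0 :|: C); apply: IHy => //; constructor 1.
have gP : good P by case: cP => [[]|bP|[]] //; right; exists B.
have gQ : good Q by right; exists A.
have PQ := joinedC j.
have AQ := ball_sub bQ.
case: (bQ) => x0 x0Q gx0 stA stQ.
have x0P := joined_disj j x0Q.
have stA0 : steps ball (Q :|: P) [set x0] A.
  rewrite -[[set x0]]setU0 -[A]setU0; apply: (steps_join j _ _ _ stA); rewrite ?sub0set ?sub1set //.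
  by move=> x C xQ Cx bx; apply: IHx => //; constructor 1.
have g1 : good (nb (Q :|: P) x0) by rewrite nb_join //; apply: g0x.
(* The first vertex [y0] meets nothing in [P] and the ball [A] in [Q]; an empty part is allowed
   against a ball. *)
have rest D : ball P D -> steps ball (Q :|: P) A (A :|: D).
  case=> y0 y0P gy0 stD _; have y0A : y0 \notin A.
    by apply/negP=> /(subsetP AQ); apply/negP/(joined_disj PQ).
  have bl : ball (nb (Q :|: P) y0) (A :&: nb (Q :|: P) y0).
    rewrite setUC nb_join // setUC.
    have -> : A :&: (Q :|: nb P y0) = set0 :|: A.
      by rewrite set0U; apply/setIidPl/(subset_trans AQ)/subsetUl.
    by rewrite setUC; apply: IHy => //; constructor 1.
  apply: steps_trans (steps1 _ y0A bl) _; first by rewrite inE y0P orbT.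
  rewrite [A :|: D]setUC [Q :|: P]setUC.
  apply: (steps_join PQ _ AQ _ stD); first by rewrite sub1set.
  by move=> y C yP Cy by_; apply: IHy => //; constructor 2.
have mid : steps ball (Q :|: P) A (A :|: P).
  case: (gP) => [->|[D bD]]; first by rewrite !setU0; apply: steps0.
  apply: steps_trans (rest _ bD) _.
  rewrite [A :|: D]setUC [A :|: P]setUC [Q :|: P]setUC.
  case: (bD) => _ _ _ _ stP; apply: (steps_join PQ _ AQ _ stP); first exact: ball_sub.
  move=> y C yP Cy [by_|[gy ->]]; apply: IHy => //; [by constructor 2|by constructor 3].
have last1 : steps ball_or_full (Q :|: P) (A :|: P) (Q :|: P).
  apply: (steps_join j _ _ _ stQ) => // x C xQ Cx [bx|[gx ->]].
    by left; apply: IHx => //; constructor 3.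
  by right; split=> //; apply: g0x.
case: cP => [[_ ->]|bB|[_ ->]].
- rewrite setU0; apply: (@Ball _ _ x0) => //; first by rewrite inE x0Q.
  by apply: steps_trans last1; apply: steps_mono mid => P' C; left.
- apply: (@Ball _ _ x0) => //; first by rewrite inE x0Q.
    exact: (steps_trans stA0 (rest _ bB)).
  (* The rest of [Q] meets the ball [B], so all its earlier parts are balls; full links can occur
     only in the last stretch, over [P]. *)
  apply: (@steps_trans _ _ _ (Q :|: B)).
    apply: (steps_join j AQ (ball_sub bB) _ stQ) => x C xQ Cx [bx|[gx ->]].
      by left; apply: IHx => //; constructor 2.
    by left; apply: IHx' => //; constructor 3.
  rewrite [Q :|: B]setUC [Q :|: P]setUC.
  case: (bB) => _ _ _ _ stP.
  apply: (steps_join PQ (ball_sub bB) _ _ stP) => // y C yP Cy [by_|[gy ->]].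
    left; apply: IH => //; [|exact: joined_nb|by constructor 3].
    by rewrite -ltnS; apply: leq_trans lt; rewrite ltnS addnC ltn_add2l card_nb.
  by right; split=> //; apply: g0y.
- apply: (@Ball _ _ x0) => //; first by rewrite inE x0Q.
  exact: (steps_trans stA0 mid).
Qed.

Lemma good_join Q P : joined Q P -> good Q -> good P -> good (Q :|: P).
Proof.
move=> j [-> gP|[A bA] gP]; first by rewrite set0U.
by right; exists (A :|: set0); apply: ball_join => //; constructor 1.
Qed.

(** * Shelling the subdivision of a clique complex *)

(* [s] enumerates a maximal clique of [Q]; these [s] stand for the facets of the barycentric subdivision
   of the clique complex. *)
Fixpoint listing Q s :=
  if s is x :: s' then (x \in Q) && listing (nb Q x) s' else Q == set0.

Lemma listing_ex Q : exists s, listing Q s.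
Proof.
have [n] := ubnP #|Q|; elim: n Q => // n IH Q lt.
case: (set_0Vmem Q) => [->|[x xQ]]; first by exists [::] => /=.
have [|s ls] := IH (nb Q x); first exact: leq_trans (card_nb xQ) _.
by exists (x :: s); rewrite /= xQ.
Qed.

Lemma listing_sub Q s : listing Q s -> {subset s <= Q}.
Proof.
elim: s Q => // x s IH Q /= /andP[xQ /IH sub] y.
by rewrite inE => /predU1P[-> //|/sub]; apply/subsetP/nb_sub.
Qed.

Lemma listing_cons_notin Q x s : listing Q (x :: s) -> x \notin s.
Proof.
by case/andP=> _ /listing_sub sub; apply/negP=> /sub; rewrite inE e_irr andbF.
Qed.

Lemma listing_uniq Q s : listing Q s -> uniq s.
Proof.
elim: s Q => // x s IH Q ls /=; rewrite (listing_cons_notin ls).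
by case/andP: ls => _ /IH.
Qed.

(** Both orders leave the same link of the edge [x], [y]. *)
Lemma listing_swap Q x y s : listing Q (x :: y :: s) -> listing Q (y :: x :: s).
Proof.
rewrite /= !inE e_sym => /and3P[-> /andP[-> ->]] /=.
suff -> : nb (nb Q x) y = nb (nb Q y) x by [].
by apply/setP=> z; rewrite !inE -!andbA; congr andb; rewrite andbC.
Qed.

Lemma listing_rem Q s u : listing Q s -> u \in s -> listing Q (u :: rem u s).
Proof.
elim: s Q => // x s IH Q /= /andP[xQ ls]; rewrite inE eq_sym.
case: eqP => [<- _|_ /= us]; first by rewrite xQ.
have {}ls := IH _ ls us.
by apply: listing_swap; rewrite [listing _ _]/= xQ.
Qed.

(* The facets given by [s] and [t] have the same vertex of rank [i]. *)
Definition agree i s t := [set:: take i s] == [set:: take i t].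

Lemma set_cons x s : [set:: x :: s] = x |: [set:: s].
Proof. by apply/setP=> y; rewrite !inE. Qed.

(** Moving [u] to the front only permutes the first [i] entries. *)
Lemma agree_rem i s u : u \in take i s -> agree i s (u :: rem u s).
Proof.
rewrite /agree; elim: s i => // x s IH [//|i] /=.
rewrite inE eq_sym; case: eqP => [-> //|_ /= us].
case: i us => [|i] us; first by rewrite take0 in us.
have /eqP := IH _ us; rewrite /= !set_cons => ->.
by rewrite setUCA.
Qed.

Lemma agree_cons i x s t : agree i s t -> agree i.+1 (x :: s) (x :: t).
Proof. by rewrite /agree /= !set_cons => /eqP->. Qed.

Lemma agree_consI i x s t : x \notin s -> x \notin t ->
  agree i.+1 (x :: s) (x :: t) -> agree i s t.
Proof.
move=> xs xt; rewrite /agree /= !set_cons => /eqP eqs; apply/eqP/setP=> y.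
have := congr1 (fun A : {set U} => y \in A) eqs; rewrite !inE.
case: eqP => [-> _|//].
by rewrite (contraNF (@mem_take i _ s x) xs) (contraNF (@mem_take i _ t x) xt).
Qed.

(* Every common face of [s] and some [t] in [L] lies in a common ridge of [s] and some [r] in [L], namely
   [s] without its vertex of rank [k]. *)
Definition attaches L s := forall t, t \in L -> exists r k,
  [/\ r \in L, 0 < k <= size s, ~~ agree k s t
    & forall i, i <= size s -> i != k -> agree i s r].

Definition shelled L := forall i, i < size L -> attaches (take i L) (nth [::] L i).

Definition starts A s := if s is x :: _ then x \in A else false.

Definition shelling_of Q A L :=
  [/\ uniq L, shelled L & forall s, (s \in L) = listing Q s && starts A s].

(** A shelling whose initial segment [L1] is the regular neighbourhood of [A]. The empty
    enumeration, present when [Q] is empty, starts nowhere and falls into [L2]. *)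
Definition shells_from Q A := exists L1 L2,
  [/\ uniq (L1 ++ L2), shelled (L1 ++ L2),
      forall s, (s \in L1) = listing Q s && starts A s
    & forall s, (s \in L1 ++ L2) = listing Q s].

(** The enumerations [x :: s] are appended to [L] in the order of the shelling of the link of [x].
    The disjunction provides a member of [L1] wherever one is needed to attach to [L]. *)
Lemma shelling_step Q A x L : x \in Q -> x \notin A ->
  shells_from (nb Q x) (A :&: nb Q x) ->
  [\/ A = set0, nb Q x = set0 | A :&: nb Q x != set0] ->
  shelling_of Q A L -> exists L', shelling_of Q (x |: A) (L ++ L').
Proof.
move=> xQ xA [L1 [L2 [unq sh memL1 memL12]]] nonempty [uL shL memL].
set M := L1 ++ L2 in unq sh memL12.
have consI : injective (cons x) by move=> s t [].
exists (map (cons x) M); split.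
- rewrite cat_uniq uL map_inj_uniq // unq andbT /=.
  apply/hasPn=> _ /mapP[s sM ->].
  by rewrite memL /= (negPf xA) !andbF.
- move=> i; rewrite size_cat size_map take_cat nth_cat.
  case: (ltnP i (size L)) => [lt _|le lt]; first exact: shL.
  have {lt}: i - size L < size M by rewrite ltn_subLR.
  move: (i - size L) => {le}j lt.
  rewrite (nth_map [::]) // -map_take.
  set s := nth [::] M j.
  have sM : s \in M by apply: mem_nth.
  have ls : listing (nb Q x) s by rewrite -memL12.
  have lxs : listing Q (x :: s) by rewrite /= xQ.
  have xs := listing_cons_notin lxs.
  have sj := sh j lt; rewrite -/s in sj.
  (* Prefixing [x] raises every rank by one, hence [1 < k] and the comparison at rank [k.-1]. *)
  have lift t' : t' \in take j M -> exists r k, [/\ r \in L ++ map (cons x) (take j M),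
     0 < k <= size (x :: s), 1 < k, ~~ agree k.-1 s t' & forall i, i <= size (x :: s) -> i != k ->
     agree i (x :: s) r].
    move=> /sj [r [k [rM kk nag ag]]]; exists (x :: r), k.+1; split=> //.
    + by rewrite mem_cat map_f ?orbT.
    + by case/andP: kk => _ ks; rewrite /= ltnS.
    + by case/andP: kk => k0 _; rewrite ltnS.
    + case=> [|i']; first by rewrite /agree !take0.
      by rewrite /= ltnS eqSS => /ag{}ag /ag; apply: agree_cons.
  move=> t; rewrite mem_cat => /orP[|/mapP[t' t'M ->{t}]]; last first.
    have [r [k [rM kk k1 nag ag]]] := lift _ t'M.
    exists r, k; split=> //; apply: contra nag; rewrite -{1}(ltn_predK k1).
    apply: agree_consI => //; apply: (@listing_cons_notin Q); rewrite /= xQ -memL12.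
    exact: mem_take t'M.
  move=> tL; have := tL; rewrite memL => /andP[lt_].
  case: t lt_ tL => // u t lut utL; rewrite /starts => uA.
  have ux : u != x by apply: contraNneq xA => <-.
  (* If [s] starts in [A], swap the first two entries of [x :: s]. Otherwise compare [s] with an
     enumeration starting in [A], obtained by moving [u] to the front of [s] when [u] occurs there. *)
  case s_def : s => [|u' w].
    (* With [s] empty the flag has only its vertex of rank 1, and omitting it leaves nothing to
       compare. *)
    exists (u :: t), 1; split=> //; first by rewrite mem_cat utL.
      rewrite /agree /= !take0; apply/eqP=> /setP/(_ x); rewrite !inE eqxx eq_sym.
      by rewrite (negPf ux).
    by case=> [|[|//]] // _ _; rewrite /agree !take0.
  case u'A : (u' \in A).
    exists (u' :: x :: w), 1; split=> //.
    + rewrite mem_cat memL /starts u'A andbT; rewrite s_def in lxs.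
      by rewrite (listing_swap lxs).
    + rewrite /agree /= !take0; apply/eqP=> /setP/(_ x); rewrite !inE eqxx eq_sym.
      by rewrite (negPf ux).
    + by case=> [|[|i']] // _ _; rewrite /agree ?take0 //= !set_cons setUCA.
  have sL1 : s \notin L1 by rewrite memL1 s_def /starts inE u'A andbF.
  have L1j t'' : t'' \in L1 -> t'' \in take j M.
    move=> t1; rewrite /M take_cat; case: ltnP => [jlt|_]; last by rewrite mem_cat t1.
    by move: sL1; rewrite /s /M nth_cat jlt mem_nth.
  suff [t'' t''L ag'] : exists2 t'', t'' \in L1 &
      forall k, agree k.+1 (x :: s) (u :: t) -> agree k s t''.
    have [r [k [rM kk k1 nag ag]]] := lift _ (L1j _ t''L).
    rewrite -s_def; exists r, k; split=> //; apply: contra nag => a.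
    by apply: ag'; rewrite (ltn_predK k1).
  have agu k : agree k.+1 (x :: s) (u :: t) -> u \in take k s.
    rewrite /agree => /eqP/setP/(_ u); rewrite !inE eqxx (negPf ux) /=.
    by move->.
  case us : (u \in s).
    exists (u :: rem u s); last by move=> k /agu; apply: agree_rem.
    by rewrite memL1 (listing_rem ls us) /= inE uA (listing_sub ls us).
  (* If [u] is absent from [s], then [agree k.+1 (x :: s) (u :: t)] never holds, and any member of
     [L1] serves. *)
  have [v vA] : exists v, v \in A :&: nb Q x.
    apply/set0Pn; case: nonempty => // [A0|n0]; first by rewrite A0 inE in uA.
    by move: ls; rewrite s_def /= n0 inE.
  have vQ : v \in nb Q x by move: vA; rewrite inE => /andP[].
  have [q lq] := listing_ex (nb (nb Q x) v).
  exists (v :: q); first by rewrite memL1 /= vQ lq vA.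
  by move=> k /agu /mem_take; rewrite us.
- move=> s; rewrite mem_cat memL.
  case: s => [|y s] /=; first by rewrite !andbF /=; apply/negbTE/mapP=> -[].
  rewrite !inE andb_orr orbC; congr orb.
  apply/mapP/andP=> [[s' s'M [-> ->]]|[/andP[yQ ls] /eqP yx]].
    by rewrite xQ -memL12.
  by subst y; exists s; rewrite ?memL12.
Qed.

Lemma shelling_steps R Q A A' L :
  (forall x B, x \in Q -> R (nb Q x) B -> shells_from (nb Q x) B /\ (nb Q x = set0 \/ B != set0)) ->
  steps R Q A A' -> shelling_of Q A L -> exists L', shelling_of Q A' (L ++ L').
Proof.
move=> RS st; elim: st L => [B L sL|x B B' xQ xB Rx _ IH L sL].
  by exists [::]; rewrite cats0.
have [sx nx] := RS x _ xQ Rx.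
have [|L1 /IH[L2 sL2]] := shelling_step xQ xB sx _ sL.
  by case: nx => ?; [constructor 2|constructor 3].
by exists (L1 ++ L2); rewrite catA.
Qed.

(** One shelling is regrouped: all of it goes into [L2] for the start [set0], and into [L1] for the
    start [Q] unless [Q] is empty. *)
Lemma good_shells Q : (forall A, ball Q A -> shells_from Q A) -> good Q ->
  shells_from Q set0 /\ shells_from Q Q.
Proof.
have st0 s : starts set0 s = false by case: s => //= x s; rewrite inE.
move=> H [->|[A /H[L1 [L2 [unq sh mem1 mem2]]]]].
  suff S : shells_from set0 set0 by [].
  exists [::], [:: [::]]; split=> // [[|i] //|s|[|x s]] //=; rewrite ?st0 ?andbF ?inE ?eqxx //=.
split.
  by exists [::], (L1 ++ L2); split=> // s; rewrite st0 andbF.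
case: (set_0Vmem Q) => [Q0|[x xQ]].
  by exists [::], (L1 ++ L2); split=> // s; rewrite Q0 st0 andbF.
exists (L1 ++ L2), [::]; rewrite cats0; split=> // s; rewrite mem2.
case: s => [|y s] /=; last by case: (y \in Q); rewrite ?andbF ?andbT.
by rewrite ?andbF; apply/negbTE/eqP=> Q0; rewrite Q0 inE in xQ.
Qed.

(** Induction on [#|Q|], with [shelling_step] at each vertex of the order. Its disjunction holds
    because nothing precedes the first vertex, balls are nonempty, and a full part is empty only if
    the link is. *)
Lemma ball_shells Q A : ball Q A -> shells_from Q A.
Proof.
have [n] := ubnP #|Q|; elim: n Q A => // n IH Q A lt [x xQ gx st1 st2].
have IHx y B : y \in Q -> ball (nb Q y) B -> shells_from (nb Q y) B.
  move=> yQ; apply: IH; exact: leq_trans (card_nb yQ) _.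
have ball_n0 P B : ball P B -> B != set0.
  case=> y yP _ st _; apply/set0Pn; exists y.
  by apply: (subsetP (steps_sub st)); rewrite inE.
have gS y : y \in Q -> good (nb Q y) ->
    shells_from (nb Q y) set0 /\ shells_from (nb Q y) (nb Q y).
  by move=> yQ; apply: good_shells => B; apply: IHx.
have sh0 : shelling_of Q set0 [::].
  by split=> // s; case: s => [|y s]; rewrite /= ?inE ?andbF.
have x0 : x \notin set0 by rewrite inE.
have sx0 : shells_from (nb Q x) (set0 :&: nb Q x).
  by rewrite set0I; have [] := gS x xQ gx.
have [L0 sL0] := shelling_step xQ x0 sx0 (Or31 _ _ erefl) sh0.
rewrite setU0 /= in sL0.
have [|L1 sL1] := shelling_steps _ st1 sL0.
  by move=> y B yQ b; split; [apply: IHx|right; apply: ball_n0 b].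
have [|L2 [unq sh mem2]] := shelling_steps _ st2 sL1.
  move=> y B yQ [b|[g ->]]; first by split; [apply: IHx|right; apply: ball_n0 b].
  by split; [have [] := gS y yQ g | case: eqP; [left|right]].
exists (L0 ++ L1), L2; split=> //; first by case: sL1.
move=> s; rewrite mem2; case: s => [|y s] /=; last by case: (y \in Q); rewrite ?andbF ?andbT.
by rewrite ?andbF; symmetry; apply/negbTE/eqP=> Q0; rewrite Q0 inE in xQ.
Qed.

Lemma good_shelled Q : good Q ->
  exists L, [/\ uniq L, shelled L & forall s, (s \in L) = listing Q s].
Proof.
case/(good_shells (@ball_shells Q)) => -[L1 [L2 [unq sh _ mem2]]] _.
by exists (L1 ++ L2).
Qed.

(** * Flags of maximal cliques as facets of the subdivision *)

Definition cliques Q :=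
  [set P : {set U} | (P \subset Q) && [forall u in P, forall v in P, (u == v) || e u v]].

Lemma cliquesP Q P :
  reflect (P \subset Q /\ {in P &, forall u v, u != v -> e u v}) (P \in cliques Q).
Proof.
rewrite inE; apply: (iffP andP) => -[PQ H]; split=> //.
  by move=> u v uP vP; have /forall_inP/(_ _ uP)/forall_inP/(_ _ vP) := H; case: eqP.
apply/forall_inP=> u uP; apply/forall_inP=> v vP.
by case: (eqVneq u v) => //=; apply: H.
Qed.

Lemma listing_clique Q s : listing Q s -> [set:: s] \in cliques Q.
Proof.
elim: s Q => [|x s IH] Q /=.
  by move=> _; apply/cliquesP; split; [apply/subsetP=> u|move=> u v]; rewrite inE.
case/andP=> xQ /IH/cliquesP[/subsetP sQ cl]; apply/cliquesP; split.
  apply/subsetP=> u; rewrite !inE => /predU1P[-> //|us].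
  by have := sQ u; rewrite !inE us => /(_ isT)/andP[].
have ex v : v \in s -> e x v.
  by move=> vs; have := sQ v; rewrite !inE vs => /(_ isT)/andP[].
move=> u v; rewrite !inE => /predU1P[->|us] /predU1P[->|vs]; rewrite ?eqxx //.
- by move=> _; apply: ex.
- by move=> _; rewrite e_sym; apply: ex.
- by apply: cl; rewrite inE.
Qed.

Lemma listing_maximal Q s u : listing Q s -> u \in Q ->
  (forall v, v \in s -> u != v -> e u v) -> u \in s.
Proof.
elim: s Q => [|x s IH] Q /=; first by move=> /eqP->; rewrite inE.
case/andP=> xQ ls uQ eu; rewrite inE; case: eqVneq => //= ux.
apply: IH ls _ _; last by move=> v vs; apply: eu; rewrite inE vs orbT.
by rewrite inE uQ e_sym eu ?inE ?eqxx.
Qed.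

Definition flag s := [set [set:: take i.+1 s] | i : 'I_(size s)].

Lemma flagP s A : reflect (exists i, 0 < i <= size s /\ A = [set:: take i s]) (A \in flag s).
Proof.
apply: (iffP imsetP) => [[i _ ->]|[[|i] [] // lt ->]]; first by exists i.+1; rewrite ltn_ord.
by exists (Ordinal lt).
Qed.

Lemma card_set_take i s : uniq s -> i <= size s -> #|[set:: take i s]| = i.
Proof.
by move=> us le; rewrite cardsE (card_uniqP _) ?take_uniq // size_takel.
Qed.

Lemma card_flag s : uniq s -> #|flag s| = size s.
Proof.
move=> us; rewrite card_imset ?card_ord // => i j eqij; apply/val_inj.
have := congr1 (fun A : {set U} => #|A|) eqij.
by rewrite !card_set_take // => -[].
Qed.

(** The vertices of a flag have distinct cardinalities, so a common vertex has the same rank in both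
    flags. *)
Lemma flag_agree i s t : uniq s -> uniq t -> 0 < i <= size s ->
  [set:: take i s] \in flag t -> agree i s t.
Proof.
move=> us ut /andP[i0 is_] /flagP[j [/andP[j0 jt] eqij]].
have := congr1 (fun A : {set U} => #|A|) eqij.
by rewrite !card_set_take // /agree eqij => ->.
Qed.

Lemma agree_eq s t : uniq s -> uniq t -> size s = size t ->
  (forall i, i <= size s -> agree i s t) -> s = t.
Proof.
elim: s t => [|x s IH] [|y t] //= /andP[xs us] /andP[yt ut] [st] ag.
have := ag 1 isT; rewrite /agree /= !take0 => /eqP/setP/(_ x).
rewrite !inE eqxx => /esym/eqP xy; subst y; congr cons; apply: IH => // i le.
exact: (agree_consI xs yt (ag i.+1 le)).
Qed.

Lemma flag_inj s t : uniq s -> uniq t -> size s = size t -> flag s = flag t -> s = t.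
Proof.
move=> us ut st fst; apply: agree_eq => // -[|i] le; first by rewrite /agree !take0.
by apply: flag_agree; rewrite -?fst //; apply/flagP; exists i.+1.
Qed.

Lemma take_chain s i j : ([set:: take i s] \subset [set:: take j s]) ||
  ([set:: take j s] \subset [set:: take i s]).
Proof.
wlog le : i j / i <= j => [W|]; first by case/orP: (leq_total i j) => /W //; rewrite orbC.
apply/orP; left; apply/subsetP=> u; rewrite !inE.
by rewrite -(take_takel _ le) => /mem_take.
Qed.

Lemma flag_sd Q s : listing Q s -> flag s \in sd (cliques Q).
Proof.
move=> ls; rewrite inE; apply/and3P; split.
- apply/subsetP=> _ /flagP[i [_ ->]]; apply/cliquesP.
  have /cliquesP[/subsetP sQ cl] := listing_clique ls; split.
    by apply/subsetP=> u; rewrite inE => /mem_take us; apply: sQ; rewrite inE.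
  by move=> u v; rewrite !inE => /mem_take us /mem_take vs; apply: cl; rewrite inE.
- apply/flagP=> -[[|i] [] // lt]; case: s ls lt => // x s _ _ /setP/(_ x).
  by rewrite !inE eqxx.
- apply/forall_inP=> _ /flagP[i [_ ->]]; apply/forall_inP=> _ /flagP[j [_ ->]].
  exact: take_chain.
Qed.

(** An element [x] of the least member lies in all members; deleting it leaves a chain of cliques in
    the link of [x], where induction applies. *)
Lemma sd_flag Q (C : {set {set U}}) : C \in sd (cliques Q) ->
  exists2 s, listing Q s & C \subset flag s.
Proof.
have [n] := ubnP #|Q|; elim: n Q C => // n IH Q C lt.
rewrite inE => /and3P[/subsetP CQ C0 /forall_inP chain].
have common x : x \in Q -> (forall A, A \in C -> x \in A) ->
    exists2 s, listing Q s & C \subset flag s.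
  (* The member [[set x]] becomes empty and is discarded; it returns as the vertex of rank 1. *)
  move=> xQ xC; pose C' := [set A :\ x | A in C] :\ set0.
  have [||s ls C's] := IH (nb Q x) C'.
  - by rewrite -ltnS; apply: leq_trans lt; rewrite ltnS (card_nb).
  - rewrite inE; apply/and3P; split.
    + apply/subsetP=> _ /setD1P[_ /imsetP[A AC ->]].
      have /cliquesP[/subsetP AQ cl] := CQ A AC; apply/cliquesP; split.
        apply/subsetP=> u; rewrite !inE => /andP[ux uA]; rewrite AQ //=.
        by apply: cl; rewrite ?xC // eq_sym.
      by move=> u v /setD1P[_ uA] /setD1P[_ vA]; apply: cl.
    + by rewrite !inE eqxx.
    + apply/forall_inP=> _ /setD1P[_ /imsetP[A AC ->]].
      apply/forall_inP=> _ /setD1P[_ /imsetP[B BC ->]].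
      by have /forall_inP/(_ _ BC)/orP[AB|BA] := chain A AC;
        rewrite ?(setSD _ AB) ?(setSD _ BA) ?orbT.
  exists (x :: s); first by rewrite /= xQ.
  apply/subsetP=> A AC; have A_eq := setD1K (xC A AC).
  case: (eqVneq (A :\ x) set0) => [A0|An0].
    by apply/flagP; exists 1; rewrite -A_eq A0 /= take0 set_cons; split.
  have : A :\ x \in C' by rewrite !inE An0; apply/imsetP; exists A.
  move=> /(subsetP C's)/flagP[i [/andP[i0 is_] Ai]].
  by apply/flagP; exists i.+1; rewrite -A_eq Ai /= set_cons.
case: (set_0Vmem C) => [C_0|[A0 A0C]].
  case: (set_0Vmem Q) => [Q0|[x xQ]]; last by apply: common xQ _ => A; rewrite C_0 inE.
  by exists [::]; rewrite /= ?Q0 // C_0 sub0set.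
have [A AC minA] := @arg_minnP _ A0 (mem C) (fun A => #|A|) A0C.
have {}AC : A \in C by [].
have [x xA] : exists x, x \in A by apply/set0Pn; apply: contraNneq C0 => <-.
have /cliquesP[/subsetP AQ _] := CQ A AC.
apply: (common x (AQ x xA)) => B BC.
have /forall_inP/(_ _ BC)/orP[/subsetP->//|BA] := chain A AC.
by have /eqP-> : B == A by rewrite eqEcard BA; apply: minA.
Qed.

Section Pure.
Variables (Q : {set U}) (n : nat).
Hypothesis listing_size : forall s, listing Q s -> size s = n.

Lemma facets_sd F :
  reflect (exists2 s, listing Q s & F = flag s) (F \in facets (sd (cliques Q))).
Proof.
rewrite inE; apply: (iffP maxsetP) => [[/sd_flag[s ls Fs] max]|[s ls ->]].
  by exists s => //; apply/esym/max => //; apply: flag_sd.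
split=> [|C /sd_flag[t lt Ct] sC]; first exact: flag_sd.
apply/eqP; rewrite eq_sym eqEcard sC (leq_trans (subset_leq_card Ct)) //.
by rewrite !card_flag ?(listing_uniq ls) ?(listing_uniq lt) // !listing_size.
Qed.

Lemma shelled_shellable : good Q -> shellable (sd (cliques Q)).
Proof.
move=> gQ; have [L [uL shL memL]] := good_shelled gQ.
have uls s : listing Q s -> uniq s by apply: listing_uniq.
exists (n%:Z - 1)%R.
  apply: pure_of_dim_card.
    by have [s ls] := listing_ex Q; exists (flag s); apply: flag_sd.
  move=> C /sd_flag[s ls Cs]; exists (flag s) => //; split; first exact: flag_sd.
  by rewrite card_flag ?uls // listing_size.
exists (map flag L); split.
- rewrite map_inj_in_uniq // => s t; rewrite !memL => ls lt; apply: flag_inj; rewrite ?uls //.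
  by rewrite !listing_size.
- move=> F; apply/mapP/facets_sd=> [[s sL ->]|[s ls ->]]; exists s; rewrite ?memL //.
  by rewrite -memL.
rewrite size_map => i /andP[i0 iL]; have sh := shL i iL.
rewrite (nth_map [::]) //; set s := nth [::] L i in sh *.
have ls : listing Q s by rewrite -memL mem_nth.
have us := uls s ls.
set D := _ :&: _.
have DP (G : {set {set U}}) :
    reflect (G \subset flag s /\ exists2 t, t \in take i L & G \subset flag t) (G \in D).
  rewrite inE powersetE; apply: (iffP andP) => -[Gs].
    case/bigcupP=> j _; rewrite powersetE (nth_map [::]); last exact: ltn_trans iL.
    move=> Gt; split=> //; exists (nth [::] L j) => //.
    by rewrite -(nth_take _ (ltn_ord j)) mem_nth // size_takel // ltnW.
  case=> t /(nthP [::])[j]; rewrite size_takel ?(ltnW iL) // => ji <- Gt; split=> //.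
  apply/bigcupP; exists (Ordinal ji) => //=.
  by rewrite powersetE (nth_map [::]) ?(ltn_trans ji) // -(nth_take _ ji).
have ltL t : t \in take i L -> listing Q t by move/mem_take; rewrite memL.
(* The ridge is [flag s] without its vertex of rank [k]: disagreement at [k] keeps [G] inside it,
   and agreement elsewhere puts it into [flag r]. *)
have ridge (G : {set {set U}}) t : t \in take i L -> G \subset flag s -> G \subset flag t ->
    exists2 F : {set {set U}}, G \subset F & F \in D /\ #|F| = n.-1.
  move=> tL Gs Gt; have [r [k [rL kk nag ag]]] := sh t tL.
  have kF : [set:: take k s] \in flag s by apply/flagP; exists k.
  exists (flag s :\ [set:: take k s]).
    rewrite subsetD1 Gs; apply/negP=> /(subsetP Gt) kt; case/negP: nag.
    by apply: flag_agree kt => //; apply/uls/ltL.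
  split; last first.
    by rewrite -(listing_size ls) -(card_flag us) [in RHS](cardsD1 [set:: take k s]) kF.
  apply/DP; split; first exact: subsetDl.
  exists r => //; apply/subsetP=> A /setD1P[ne /flagP[j [/andP[j0 js] Aj]]].
  have jk : j != k by apply: contraNneq ne => <-; rewrite Aj.
  apply/flagP; exists j; rewrite j0 listing_size ?ltL // -(listing_size ls) js.
  by split=> //; rewrite Aj; apply/eqP/ag.
have t0 : nth [::] L 0 \in take i L.
  by rewrite -(nth_take _ i0) mem_nth // size_takel // ltnW.
(* An attachment has a rank [k] with [0 < k <= n], so [n.-1] is not truncated. *)
have n0 : 0 < n.
  have [r [k [_ /andP[k0 ks] _ _]]] := sh _ t0.
  by rewrite -(listing_size ls); apply: leq_trans ks.
have -> : (n%:Z - 1 - 1 = n.-1%:Z - 1)%R by rewrite -[in LHS](prednK n0) -addn1 PoszD GRing.addrK.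
apply: pure_of_dim_card.
  exists set0; apply/DP; rewrite sub0set; split=> //.
  by exists (nth [::] L 0) => //; rewrite sub0set.
by move=> G /DP[Gs [t tL Gt]]; apply: ridge tL Gs Gt.
Qed.
End Pure.

End CliqueComplexes.

(** * Collapses and face posets *)

Section FacePosets.
Variable T : finType.
Implicit Types (K L M : {set {set T}}) (s t u x y z w F : {set T}) (p q : T).

Definition nested x y := (x \proper y) || (y \proper x).

Lemma nested_sym : symmetric nested.
Proof. by move=> x y; apply: orbC. Qed.

Lemma nested_irr : irreflexive nested.
Proof. by move=> x; rewrite /nested properxx. Qed.

Local Notation nb := (nb nested).
Local Notation ball := (ball nested).
Local Notation good := (good nested).

(* For a complex [K], the poset of nonempty faces of the link of [x]. *)
Definition above K x := [set y in K | x \proper y].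
Definition between x w := [set z : {set T} | (x \proper z) && (z \proper w)].

(* Spheres are thus treated as face posets of links in the boundary of a simplex. *)
Lemma above_boundary x w : above [set z : {set T} | z \proper w] x = between x w.
Proof. by apply/setP=> z; rewrite !inE andbC. Qed.

Lemma nb_above K x y : is_complex K -> y \in above K x ->
  nb (above K x) y = between x y :|: above K y.
Proof.
move=> cK; rewrite inE => /andP[yK xy]; apply/setP=> z; rewrite !inE.
case yz: (y \proper z).
  rewrite /nested yz (proper_trans xy yz) !andbT.
  case zy: (z \proper y) => //=.
  by have := proper_trans yz zy; rewrite properxx.
rewrite /nested yz andbF orbF.
case zy: (z \proper y); rewrite ?andbF // !andbT.
by rewrite (cK y z yK (proper_sub zy)).
Qed.

Lemma joined_between K x y : joined nested (between x y) (above K y).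
Proof.
move=> u v; rewrite !inE => /andP[_ uy] /andP[_ yv].
by rewrite /nested (proper_trans uy yv).
Qed.

(* Collapsibility of the link of [x] to a point, expressed by the faces strictly above [x] and read
   backwards: [y] corresponds to the point and each pair [s], [t] to an elementary collapse. *)
Inductive grows x y : {set {set T}} -> Prop :=
| grows1 : x \proper y -> #|y| = #|x|.+1 -> grows x y [set y]
| growsS L s t : grows x y L -> x \proper s -> s \proper t -> s \notin L ->
    (forall z, x \proper z -> z \proper t -> z != s -> z \in L) ->
    (forall z, z \in L -> ~~ (s \proper z)) -> grows x y (s |: (t |: L)).

Lemma grows_start x y L : grows x y L -> y \in L.
Proof. by elim=> [_ _|L' s t _ yL *]; rewrite !inE ?eqxx ?yL ?orbT. Qed.

Lemma grows_proper x y L z : grows x y L -> z \in L -> x \proper z.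
Proof.
elim=> [xy _|L' s t _ IH xs st _ _ _]; rewrite !inE; first by move/eqP->.
by case/or3P=> [/eqP->|/eqP->|/IH //]; rewrite ?(proper_trans xs st).
Qed.

Lemma grows_down x y L z z' :
  grows x y L -> z \in L -> x \proper z' -> z' \proper z -> z' \in L.
Proof.
move=> g zL xz'; elim: g zL => [xy cy|L' s t _ IH xs st _ bd _]; rewrite !inE.
  move/eqP=> -> /proper_card; rewrite cy ltnS => le.
  by have := leq_trans (proper_card xz') le; rewrite ltnn.
case/or3P=> [/eqP->|/eqP->|zL z'z].
- move=> z's; rewrite bd ?orbT ?(proper_trans z's st) //.
  by apply: contraTneq z's => ->; rewrite properxx.
- by move=> z't; case: (z' =P s) => //= /eqP ne; rewrite bd ?orbT.
- by rewrite IH ?orbT.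
Qed.

Lemma proper1U x t p : x \proper t -> p \in t -> p \notin x ->
  p |: x = t \/ p |: x \proper t.
Proof.
move=> /proper_sub xt pt px; rewrite /= properEneq subUset sub1set pt xt andbT andbT.
by case: eqP; [left|right].
Qed.

Lemma properU1 x p : p \notin x -> x \proper p |: x.
Proof. by move=> px; rewrite properEcard subsetUr cardsU1 px add1n /=. Qed.

(** Otherwise [p |: s] would be a proper face of [t], hence a member of [L] above [s]. *)
Lemma coface_insert L x s t p : x \proper s -> s \proper t ->
  (forall z, x \proper z -> z \proper t -> z != s -> z \in L) ->
  (forall z, z \in L -> ~~ (s \proper z)) -> p \in t -> p \notin s -> p |: s = t.
Proof.
move=> xs st bd nos pt ps; case: (proper1U st pt ps) => // pst.
have ss := properU1 ps; suff /nos : p |: s \in L by rewrite ss.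
apply: bd => //; first exact: proper_trans ss.
by apply: contraTneq ss => ->; rewrite properxx.
Qed.

(** Every link met is the join of a sphere below and a link above, and [ball_join] reduces to these
    factors. From [[set y]] to [L] only balls occur, so one order gives both conclusions. *)
Lemma ball_above K x y L : is_complex K -> grows x y L -> L \subset above K x ->
  (forall z, z \in above K x -> z \notin L -> above K z = set0) ->
  (forall z, z \in above K x -> good (above K z) /\
     forall t, t \in above K z -> #|t| = #|z|.+1 -> ball (above K z) [set t]) ->
  (forall w, w \in above K x -> good (between x w) /\
     forall s, x \proper s -> s \proper w -> #|w| = #|s|.+1 ->
       ball (between x w) (between x w :\ s)) ->
  ball (above K x) [set y] /\ ball (above K x) L.
Proof.
move=> cK g LK maxK linkK sphK.
have join := ball_join nested_sym nested_irr.
(* A face outside [L] has nothing above it, so all faces below [f] lie in [L] and the full link of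
   [f] is already present, whatever the order. *)
have st2 : steps nested (ball_or_full nested) (above K x) L (above K x).
  apply: steps_all => // f B fK fL LB; right.
  rewrite nb_above // (maxK f) // setU0; split; first by have [] := sphK f fK.
  apply/setIidPr/(subset_trans _ LB)/subsetP=> z; rewrite inE => /andP[xz zf].
  apply: contraT => zL; have fKK : f \in K by move: fK; rewrite inE => /andP[].
  have zK : z \in above K x by rewrite inE xz (cK f) // proper_sub.
  by have := maxK z zK zL; move/setP/(_ f); rewrite !inE fKK zf.
have st1 : steps nested ball (above K x) [set y] L.
  elim: g LK {maxK st2} => [*|L' s t g IH xs st sL bd nos LK]; first exact: steps0.
  have [sK tK L'K] : [/\ s \in above K x, t \in above K x & L' \subset above K x].
    by move: LK; rewrite !subUset !sub1set => /and3P[].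
  have xt := proper_trans xs st.
  have tL : t \notin L' by apply: contra sL => tL'; apply: (grows_down g tL').
  have [p pt ps] : exists2 p, p \in t & p \notin s by case/properP: st.
  have ct : #|t| = #|s|.+1.
    by rewrite -(coface_insert xs st bd nos pt ps) cardsU1 ps.
  have above_out z : z \in L' -> s \proper z = false by move/nos/negbTE.
  apply: steps_trans (IH L'K) _; apply: (@stepsS _ _ _ _ t) => //.
    rewrite nb_above //.
    (* Below [t] only [s] is missing; a face of [L'] above [t] would also lie above [s], which is
       excluded. *)
    have -> : L' :&: (between x t :|: above K t) = (between x t :\ s) :|: set0.
      apply/setP=> z; rewrite !inE orbF; case: (eqVneq z s) => [->|zs] /=.
        by rewrite (negPf sL).
      case xz: (x \proper z); case zt: (z \proper t) => //=.
      + by rewrite (bd z).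
      + case zL: (z \in L') => //=; case tz: (t \proper z); rewrite ?andbF //.
        by have := above_out z zL; rewrite (proper_trans st tz).
      + by case zL: (z \in L') => //; rewrite (grows_proper g zL) in xz.
      + by case zL: (z \in L') => //; rewrite (grows_proper g zL) in xz.
    apply: join; first exact: joined_between.
      by have [_] := sphK t tK; apply.
    by constructor 1; have [] := linkK t tK.
  apply: steps1 => //.
    rewrite !inE negb_or sL andbT; apply: contraTneq st => ->; by rewrite properxx.
  rewrite nb_above // [X in ball X]setUC.
  have -> : (t |: L') :&: (between x s :|: above K s) = [set t] :|: between x s.
    apply/setP=> z; rewrite !inE; case: (eqVneq z t) => [->|zt] /=.
      by rewrite st; case/setIdP: tK => -> _; rewrite orbT.
    case zL: (z \in L') => /=.
      by rewrite above_out // andbF orbF.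
    case: andP => //= -[xz zs]; rewrite -zL bd //; first exact: proper_trans zs st.
    by apply: contraTneq zs => ->; rewrite properxx.
  apply: join; first exact/(joinedC nested_sym)/joined_between.
    have [_] := linkK s sK; apply=> //.
    by rewrite inE st andbT; case/setIdP: tK.
  by constructor 3; split=> //; have [] := sphK s sK.
have yK := subsetP LK _ (grows_start g).
have gy : good (nb (above K x) y).
  rewrite nb_above //; apply: (good_join nested_sym nested_irr).
  - exact: joined_between.
  - by have [] := sphK y yK.
  - by have [] := linkK y yK.
split; exists y => //; first exact: steps0.
by apply: steps_trans st2; apply: steps_mono st1; left.
Qed.

(** * Cones and boundaries of simplices *)

Lemma setD1_id p z : p \notin z -> z :\ p = z.
Proof. by move=> pz; apply/setDidPl; rewrite disjoint_sym disjoints1. Qed.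

Lemma setD1_eq p z x : p \notin x -> (z :\ p == x) = (z == x) || (z == p |: x).
Proof.
move=> px; apply/eqP/orP=> [<-|[] /eqP ->]; last by rewrite setU1K.
  case: (boolP (p \in z)) => pz; first by right; rewrite setD1K.
  by left; rewrite setD1_id.
exact: setD1_id.
Qed.

Lemma grows_cone x s p M : p \notin s -> x \proper s -> M \subset between x s ->
  (forall z z', z \in M -> x \proper z' -> z' \proper z -> z' \in M) ->
  grows x (p |: x) [set z : {set T} | (x \proper z) && (z :\ p \in x |: M)].
Proof.
move=> ps xs; have px : p \notin x by apply: contra ps; apply/subsetP/proper_sub.
have [n] := ubnP #|M|; elim: n M => // n IH M lt Ms dM.
case: (set_0Vmem M) => [M0|[r0 r0M]].
  suff -> : [set z : {set T} | (x \proper z) && (z :\ p \in x |: M)] = [set p |: x].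
    by apply: grows1; rewrite ?properU1 // cardsU1 px.
  apply/setP=> z; rewrite M0 !inE orbF setD1_eq // andb_orr.
  case: (eqVneq z x) => [->|_]; rewrite ?properxx ?andbF //=.
    by symmetry; apply/eqP=> e; rewrite e setU11 in px.
  by case: (eqVneq z (p |: x)) => [->|]; rewrite ?properU1 ?andbF.
have [r rM max_r] := @arg_maxnP _ r0 (mem M) (fun z => #|z|) r0M.
have {}rM : r \in M by [].
have {}max_r z : z \in M -> ~~ (r \proper z).
  by move=> /max_r /= le; apply/negP=> /proper_card; rewrite ltnNge le.
have notin_s z : z \subset s -> p \notin z.
  by move=> zs; apply: contra ps; apply: (subsetP zs).
have [xr rs] : x \proper r /\ r \proper s.
  by have := subsetP Ms r rM; rewrite inE => /andP.
have pr := notin_s r (proper_sub rs).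
set N := [set z : {set T} | (x \proper z) && (z :\ p \in x |: (M :\ r))].
suff -> : [set z : {set T} | (x \proper z) && (z :\ p \in x |: M)] = r |: ((p |: r) |: N).
  apply: growsS => //.
  - apply: IH.
    + rewrite -ltnS; apply: leq_trans lt; rewrite ltnS [X in _ < X](cardsD1 r) rM.
      by rewrite add1n.
    + exact: subset_trans (subsetDl _ _) Ms.
    + move=> z z'; rewrite !inE => /andP[zr zM] xz' z'z; rewrite (dM z) // andbT.
      by apply: contraNneq (max_r z zM) => <-.
  - exact: properU1.
  - by rewrite !inE xr /= setD1_id // eqxx orbF; apply: contraTneq xr => ->; rewrite properxx.
  - move=> z xz zpr zr; rewrite !inE xz /=.
    have zDr : z :\ p \subset r by rewrite subDset proper_sub.
    have zDn : z :\ p != r.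
      rewrite setD1_eq // negb_or zr; apply: contraTneq zpr => ->; by rewrite properxx.
    rewrite zDn /=; case: (x =P z :\ p) => [->|/eqP ne]; first by rewrite eqxx.
    rewrite (dM r) ?orbT // properEneq ?zDn ?zDr //.
    rewrite ne /= subsetD1 px andbT; exact: proper_sub.
  - move=> z; rewrite !inE => /andP[xz]; apply: contraL => rz.
    have rz' : r \subset z :\ p by rewrite subsetD1 pr andbT proper_sub.
    rewrite negb_or; apply/andP; split.
      by apply: contraTneq xr => <-; rewrite properE rz' andbF.
    rewrite negb_and negbK; case: eqP => //= ne; apply: contraL rz' => zM.
    by apply: contra (max_r _ zM) => rz'; rewrite properEneq rz' andbT; apply/eqP=> /esym.
apply/setP=> z; rewrite !inE.
case: (eqVneq z r) => [->|zr] /=.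
  by rewrite xr setD1_id ?rM ?orbT.
case: (eqVneq z (p |: r)) => [->|zpr] /=.
  by rewrite setU1K // rM orbT andbT; apply: proper_trans xr (properU1 pr).
by rewrite [z :\ p == r]setD1_eq // (negPf zr) (negPf zpr).
Qed.

(** The boundary of a simplex without the facet opposite [p] is the cone with apex [p] over the
    boundary of that facet. *)
Lemma sphere_grows x w p : p \in w -> x \proper w :\ p ->
  grows x (p |: x) (between x w :\ (w :\ p)).
Proof.
move=> pw xs; have ps : p \notin w :\ p by rewrite !inE eqxx.
have px : p \notin x by apply: contra ps; apply/subsetP/proper_sub.
suff -> : between x w :\ (w :\ p)
        = [set z : {set T} | (x \proper z) && (z :\ p \in x |: between x (w :\ p))].
  apply: (grows_cone ps xs) => [|z z']; first exact: subxx.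
  rewrite !inE => /andP[_ zs] -> z'z; exact: proper_trans zs.
have zDe z : (z :\ p == w :\ p) = (z == w :\ p) || (z == w) by rewrite setD1_eq // setD1K.
have zD z : (z :\ p \subset w :\ p) = (z \subset w).
  by rewrite subDset setD1K.
apply/setP=> z; rewrite !inE andbCA; case xz: (x \proper z) => //=.
apply/idP/idP => [/andP[zs zw]|H].
  have -> : z :\ p \proper w :\ p.
    by rewrite properEneq zDe zD negb_or zs proper_neq ?proper_sub.
  by rewrite andbT eq_sym -subEproper subsetD1 px andbT proper_sub.
have : z :\ p \proper w :\ p by case/orP: H => [/eqP->|/andP[]].
by rewrite properEneq zDe zD negb_or properEneq -andbA.
Qed.

Lemma sphere_ball x w : x \proper w -> [/\ good (between x w),
  forall s, x \proper s -> s \proper w -> #|w| = #|s|.+1 -> ball (between x w) (between x w :\ s)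
  & forall t, t \in between x w -> #|t| = #|x|.+1 -> ball (between x w) [set t]].
Proof.
have [n] := ubnP (#|w| - #|x|); elim: n x w => // n IH x w lt xw.
have cone p : p \in w -> x \proper w :\ p ->
    ball (between x w) [set p |: x] /\ ball (between x w) (between x w :\ (w :\ p)).
  move=> pw xs; set K := [set z : {set T} | z \proper w].
  have eqK z : between z w = above K z by rewrite above_boundary.
  rewrite eqK; apply: ball_above.
  - by move=> s t; rewrite !inE => sw ts; apply: sub_proper_trans sw.
  - by rewrite -eqK; apply: sphere_grows.
  - exact: subsetDl.
  - move=> z; rewrite -!eqK inE => /andP[xz zw]; rewrite !inE xz zw !andbT negbK => /eqP z_eq.
    apply/setP=> t; rewrite !inE z_eq; apply/negbTE/andP=> -[st tw].
    have := proper_card tw; rewrite (cardsD1 p w) pw add1n ltnS leqNgt.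
    by rewrite (proper_card st).
  - move=> z; rewrite -!eqK inE => /andP[xz zw].
    have [|//|g _ b] := IH z w; last by split.
    rewrite -ltnS; apply: leq_trans lt; rewrite ltnS ltn_sub2l ?proper_card //.
  - move=> u; rewrite -eqK inE => /andP[xu uw].
    have [|//|g b _] := IH x u; last by split.
    by rewrite -ltnS; apply: leq_trans lt; rewrite ltnS ltn_sub2r ?proper_card.
have D1_proper p z : p \in z -> p \notin x -> x \subset z -> z \proper w -> x \proper w :\ p.
  move=> pz px xz /properP[zw [q qw qz]]; apply/properP; split.
    by rewrite subsetD1 px proper_sub.
  exists q; last by apply: contra qz; apply: (subsetP xz).
  by rewrite !inE qw andbT; apply: contraNneq qz => ->.
split.
- case: (set_0Vmem (between x w)) => [->|[z]]; first by left.
  rewrite inE => /andP[xz zw].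
  have [xz' [p pz px]] := properP xz.
  have [b _] := cone p (subsetP (proper_sub zw) p pz) (D1_proper p z pz px xz' zw).
  by right; exists [set p |: x].
- move=> s xs sw cs.
  have [_ [p pw ps]] := properP sw.
  have s_eq : s = w :\ p.
    apply/eqP; rewrite eqEcard subsetD1 ps proper_sub //=.
    by rewrite -ltnS -cs [X in _ < X](cardsD1 p) pw.
  by rewrite s_eq in xs *; have [] := cone p pw xs.
- move=> t; rewrite inE => /andP[xt tw] ct.
  have [xt' [p pt px]] := properP xt.
  have t_eq : p |: x = t.
    by apply/eqP; rewrite eqEcard subUset sub1set pt proper_sub //= ct cardsU1 px.
  have pw := subsetP (proper_sub tw) p pt.
  by rewrite -t_eq; have [] := cone p pw (D1_proper p t pt px xt' tw).
Qed.

(** * Moving the end vertex of a collapse *)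

Lemma grows_start_atom x y L : grows x y L -> x \proper y /\ #|y| = #|x|.+1.
Proof. by elim. Qed.

Lemma proper_atom x z s : #|s| = #|x|.+1 -> x \proper z -> ~~ (z \proper s).
Proof.
move=> cs /proper_card xz; apply/negP=> /proper_card; rewrite cs ltnS.
by move/(leq_trans xz); rewrite ltnn.
Qed.

Lemma between_join x u s z : x \subset u -> x \subset s -> #|u| = #|x|.+1 -> #|s| = #|x|.+1 ->
  x \proper z -> z \proper u :|: s -> z != u -> z = s.
Proof.
move=> xu xs cu cs xz zus zu.
have cus : #|u :|: s| <= #|x|.+2.
  have xus : #|x| <= #|u :&: s| by apply: subset_leq_card; rewrite subsetI xu.
  by rewrite cardsU cu cs leq_subLR addSnnS leq_add2r.
have cz : #|z| = #|x|.+1.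
  apply/eqP; rewrite eqn_leq proper_card // -ltnS andbT.
  exact: leq_trans (proper_card zus) cus.
have [q qz qu] : exists2 q, q \in z & q \notin u.
  by apply/subsetPn; apply: contra zu => zsu; rewrite eqEcard zsu cu cz leqnn.
have qs : q \in s by have := subsetP (proper_sub zus) q qz; rewrite inE (negPf qu).
have qx : q \notin x by apply: contra qu; apply: (subsetP xu).
have s_eq : q |: x = s.
  by apply/eqP; rewrite eqEcard subUset sub1set qs xs cs cardsU1 qx add1n /=.
apply/eqP; rewrite eq_sym eqEcard cz cs leqnn andbT -s_eq subUset sub1set qz.
exact: proper_sub.
Qed.

(** Geometrically, an edge [u :|: s] with new end [s] is attached at [u]. Starting from [s], the
    pair [u], [u :|: s] comes first, and the growth of [L] from [u] continues unchanged. *)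
Lemma grows_join x u L s : grows x u L -> x \proper s -> #|s| = #|x|.+1 ->
  s \notin L -> u :|: s \notin L -> grows x s (s |: ((u :|: s) |: L)).
Proof.
move=> g xs cs; have [xu cu] := grows_start_atom g.
elim: g => [_ _|L' s1 t1 g IH xs1 st1 s1L bd nos].
  rewrite !inE eq_sym => us _.
  have -> : s |: ((u :|: s) |: [set u]) = u |: ((u :|: s) |: [set s]).
    by apply/setP=> z; rewrite !inE orbC -orbA orbCA.
  apply: growsS => //.
  - exact: grows1.
  - rewrite properEcard subsetUl /= ltnNge; apply: contra us => le.
    have /eqP us : u == u :|: s by rewrite eqEcard subsetUl.
    by rewrite eq_sym eqEcard cu cs leqnn andbT us subsetUr.
  - by rewrite inE.
  - by move=> z xz zus zu; rewrite inE; apply/eqP;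
      apply: (between_join _ _ cu cs xz zus zu); apply: proper_sub.
  - by move=> z; rewrite inE => /eqP->; apply: proper_atom xu.
rewrite !inE !negb_or => /and3P[ss1 st sL] /and3P[uss1 ust usL].
have -> : s |: ((u :|: s) |: (s1 |: (t1 |: L'))) = s1 |: (t1 |: (s |: ((u :|: s) |: L'))).
  by apply/setP=> z; rewrite !inE; do ?case: (z == _) => //=; rewrite ?orbT.
apply: growsS => //; first exact: IH.
- by rewrite !inE !negb_or s1L [s1 == s]eq_sym [s1 == _]eq_sym ss1 uss1.
- by move=> z xz zt zs; rewrite !inE bd // !orbT.
- move=> z; rewrite !inE => /or3P[/eqP->|/eqP->|/nos //]; first exact: proper_atom xs1.
  apply/negP=> s1us; case/eqP: ss1; symmetry.
  apply: (between_join _ _ cu cs xs1 s1us); rewrite ?proper_sub //.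
  by apply: contraNneq s1L => ->; apply: grows_start g.
Qed.

(** If [y'] enters as the smaller face of a pair, the larger is an edge whose other end lies in
    [L']. By induction [L'] grows from that end, and [grows_join] passes to [y']. *)
Lemma grows_atom x y y' L : grows x y L -> y' \in L -> #|y'| = #|x|.+1 -> grows x y' L.
Proof.
move=> g; elim: g y' => [xy c|L' s t g IH xs st sL bd nos] y'; rewrite !inE.
  by move=> /eqP-> _; apply: grows1.
case/or3P=> [/eqP y_eq|/eqP y_eq|yL] cy; last by apply: growsS => //; apply: IH.
- subst y'; have [ts [p pt ps]] := properP st.
  have px : p \notin x by apply: contra ps; apply/subsetP/proper_sub.
  have up : p |: x \in L'.
    apply: bd; first exact: properU1.
      rewrite properEcard subUset sub1set pt (proper_sub (proper_trans xs st)) /=.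
      by rewrite cardsU1 px add1n -cy proper_card.
    by apply: contraNneq ps => <-; rewrite setU11.
  have t_eq : (p |: x) :|: s = t.
    rewrite -(coface_insert xs st bd nos pt ps) -setUA.
    by congr (_ :|: _); apply/setUidPr/proper_sub.
  rewrite -t_eq; apply: grows_join => //.
    by apply: IH => //; rewrite cardsU1 px.
  by rewrite t_eq; apply: contra sL => tL; apply: (grows_down g tL).
- by case/negP: (proper_atom cy xs); rewrite y_eq.
Qed.

(** * Collapses in links *)

Definition over x L := [set w : {set T} | (x \proper w) && (w :\: x \in L)].

Lemma setUDr x w : x :|: (w :\: x) = x :|: w.
Proof. by apply/setP=> p; rewrite !inE; case: (p \in x). Qed.

Lemma disjoint_setDr x w : [disjoint x & w :\: x].
Proof. by rewrite -setI_eq0 setDE setICA setICr setI0. Qed.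

Lemma setD_eq x w s : x \subset w -> [disjoint x & s] -> (w :\: x == s) = (w == x :|: s).
Proof.
move=> xw xs; apply/eqP/eqP=> [<-|->]; first by rewrite setUDr; apply/esym/setUidPr.
by rewrite setDUl setDv set0U; apply/setDidPl; rewrite disjoint_sym.
Qed.

(** The collapse is read backwards with [x] added to every face: a pair [s], [t] becomes [x :|: s],
    [x :|: t]. *)
Lemma collapsible_grows x K : collapsible K -> is_complex K ->
  (forall z, z \in K -> [disjoint x & z]) -> exists y, grows x y (over x K).
Proof.
elim=> {K}[v|K L [s [t [sK s0 cofaces ->]]] _ IH] cK dK.
  have vx : v \notin x.
    by have := dK [set v]; rewrite !inE eqxx orbT disjoint_sym disjoints1; apply.
  exists (v |: x); suff -> : over x [set set0; [set v]] = [set v |: x].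
    by apply: grows1; rewrite ?properU1 // cardsU1 vx.
  apply/setP=> w; rewrite !inE; case: (boolP (x \proper w)) => [xw|] /=.
    rewrite [_ == [set v]]setD_eq ?proper_sub //; last by rewrite disjoint_sym disjoints1.
    by rewrite setD_eq0 setUC; move: xw; rewrite properE => /andP[_ /negPf->].
  by move=> nxw; symmetry; apply: contraNF nxw => /eqP->; apply: properU1.
have [tK st] : t \in K /\ s \proper t.
  by have /setP/(_ t) := cofaces; rewrite !inE eqxx => /andP.
have uniq_t z : z \in K -> s \proper z -> z = t.
  by move=> zK sz; have /setP/(_ z) := cofaces; rewrite !inE zK sz => /esym/eqP.
have cL : is_complex (K :\: [set s; t]).
  move=> z z'; rewrite !inE !negb_or => /andP[/andP[zs zt] zK] z'z; rewrite (cK z) // andbT.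
  have nsz : ~~ (s \proper z) by apply: contra zt => /(uniq_t _ zK) ->.
  apply/andP; split; apply: contra nsz => /eqP z_eq; subst z'.
    by rewrite properEneq eq_sym zs.
  exact: proper_sub_trans st z'z.
have [|y g] := IH cL; first by move=> z /setDP[/dK].
exists y.
have ds := dK s sK; have dt := dK t tK.
have xs : x \proper x :|: s.
  rewrite properE subsetUl subUset subxx /=; apply: contra s0 => sx.
  by rewrite -subset0 -(disjoint_setI0 ds) subsetI sx subxx.
have stx : x :|: s \proper x :|: t.
  rewrite properE (setUS _ (proper_sub st)) /=; have [_ [p pt ps]] := properP st.
  apply/subsetPn; exists p; rewrite !inE ?pt ?orbT // negb_or ps andbT.
  by rewrite (disjointFl dt).
suff -> : over x K = (x :|: s) |: ((x :|: t) |: over x (K :\: [set s; t])).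
  apply: growsS => //.
  - rewrite !inE (@setD_eq _ _ s) ?subsetUl // eqxx /= andbF //.
  - move=> z xz zt zs; rewrite !inE xz /= -!setD_eq ?proper_sub // in zs *.
    rewrite negb_or zs /=; apply/andP; split.
      by rewrite setD_eq ?proper_sub // proper_neq.
    by apply: (cK t) => //; rewrite subDset proper_sub.
  - move=> z; rewrite !inE negb_or => /and3P[xz /andP[zs zt] zK].
    apply: contra zt => sz; apply/eqP; apply: uniq_t => //.
    rewrite properEneq eq_sym zs /= subsetD.
    by rewrite (subset_trans (subsetUr _ _) (proper_sub sz)) disjoint_sym.
apply/setP=> w; rewrite !inE; case xw: (x \proper w) => /=; last first.
  rewrite !orbF; symmetry; apply/negbTE; rewrite negb_or.
  apply/andP; split; apply: contraFneq xw => ->//.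
  exact: proper_trans stx.
rewrite -!setD_eq ?proper_sub //.
case: eqP => [->|_] /=; first by rewrite sK.
by case: eqP => [->|_] /=; first by rewrite tK.
Qed.

Lemma link_complex K x : is_complex K -> is_complex (link x K).
Proof.
move=> cK s t /imsetP[z]; rewrite inE => /andP[zK xz] -> tzx.
apply/imsetP; exists (x :|: t).
  rewrite inE subsetUl andbT; apply: (cK z) => //.
  by rewrite subUset xz (subset_trans tzx (subsetDl _ _)).
apply/esym/eqP; rewrite setD_eq ?subsetUl // disjoint_sym.
by move: tzx; rewrite subsetD => /andP[].
Qed.

Lemma mem_link K x w : x \subset w -> (w :\: x \in link x K) = (w \in K).
Proof.
move=> xw; apply/imsetP/idP=> [[z]|wK]; last by exists w; rewrite ?inE ?wK.
rewrite inE => /andP[zK xz] /eqP; rewrite setD_eq //; last first.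
  exact: disjoint_setDr.
by rewrite setUDr (setUidPr xz) => /eqP->.
Qed.

Lemma RC_grows K x : is_complex K -> x \in K -> RC (link x K) ->
  above K x = set0 \/ exists y L, [/\ grows x y L, L \subset above K x &
    forall z, z \in above K x -> z \notin L -> above K z = set0].
Proof.
move=> cK xK rc.
have [l0|l1] : link x K \subset [set set0] \/ exists2 Phi : {set {set T}},
        Phi \subset facets (link x K) & collapsible (link x K :\: Phi).
  by case: rc => [->|->|]; [left; apply: sub0set|left; apply: subxx|right].
  left; apply/setP=> w; rewrite !inE; apply/negbTE/andP=> -[wK xw].
  have := subsetP l0 (w :\: x); rewrite mem_link ?proper_sub // => /(_ wK).
  by rewrite inE setD_eq0; move: xw; rewrite properE => /andP[_ /negPf->].
right; case: l1 => Phi /subsetP PhiF coll.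
have [||y g] := collapsible_grows (x := x) coll.
- move=> s t; rewrite !inE => /andP[sPhi sl] ts.
  have tl := link_complex cK sl ts; rewrite tl andbT.
  by apply: contra sPhi => tPhi; rewrite -(facets_maximal (PhiF t tPhi) sl ts).
- move=> s /setDP[/imsetP[z _ ->] _]; exact: disjoint_setDr.
exists y, (over x (link x K :\: Phi)); split=> //.
  apply/subsetP=> w; rewrite !inE => /and3P[xw _].
  by rewrite mem_link ?proper_sub // xw => ->.
move=> z; rewrite !inE => /andP[zK xz]; rewrite xz mem_link ?proper_sub // zK andbT negbK /= => zPhi.
apply/setP=> w; rewrite !inE; apply/negbTE/andP=> -[wK zw].
have xw := proper_trans xz zw.
have := facets_maximal (PhiF _ zPhi) (t := w :\: x).
rewrite (mem_link _ (proper_sub xw)) (setSD _ (proper_sub zw)) => /(_ wK isT)/eqP.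
rewrite setD_eq ?disjoint_setDr ?(proper_sub xz) // setUDr (setUidPr (proper_sub xw)) => /eqP zwe.
by rewrite zwe properxx in zw.
Qed.

(** Induction from the top of the face poset; the second conclusion is what [ball_above] requires of
    the links of larger faces. *)
Lemma HRC_ball K : is_complex K -> pure K -> HRC K -> forall x, x \in K ->
  good (above K x) /\
  forall y, y \in above K x -> #|y| = #|x|.+1 -> ball (above K x) [set y].
Proof.
move=> cK pK hK x; have [n] := ubnP #|above K x|; elim: n x => // n IH x lt xK.
have IHx z : z \in above K x -> good (above K z) /\
     forall t, t \in above K z -> #|t| = #|z|.+1 -> ball (above K z) [set t].
  rewrite inE => /andP[zK xz]; apply: IH => //; rewrite -ltnS; apply: leq_trans lt.
  rewrite ltnS; apply/proper_card/properP; split.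
    by apply/subsetP=> w; rewrite !inE => /andP[-> zw]; apply: proper_trans xz zw.
  by exists z; rewrite !inE ?zK ?xz ?properxx.
have sph w : w \in above K x -> good (between x w) /\
     forall s, x \proper s -> s \proper w -> #|w| = #|s|.+1 ->
       ball (between x w) (between x w :\ s).
  by rewrite inE => /andP[_ /sphere_ball[]].
case: (RC_grows cK xK (hK x xK)) => [K0|[y [L [g LK maxK]]]].
  by rewrite K0; split; [left|move=> z; rewrite inE].
have bA y' M gM MK maxM := ball_above (y := y') (L := M) cK gM MK maxM IHx sph.
split; first by right; exists [set y]; have [] := bA y L g LK maxK.
move=> y' yK cy; case: (boolP (y' \in L)) => yL.
  by have [] := bA y' L (grows_atom g yL cy) LK maxK.
have [y'K xy'] : y' \in K /\ x \proper y' by move: yK; rewrite inE => /andP.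
have y'F : y' \in facets K.
  rewrite inE; apply/maxsetP; split=> // z zK yz; apply/eqP; rewrite eq_sym.
  apply: contraT => ne; have := maxK y' yK yL; move/setP/(_ z).
  by rewrite !inE zK properEneq ne yz.
have [] := bA y' [set y'] _ _ _; rewrite ?sub1set //; first exact: grows1.
move=> z; rewrite inE => /andP[zK xz] _; apply/setP=> w; rewrite !inE.
apply/negbTE/andP=> -[wK zw]; have [F FK wF] := facet_ex wK.
have := proper_atom (s := F) _ xz; rewrite -(pure_card pK y'F FK) cy => /(_ erefl)/negP; apply.
exact: proper_sub_trans wF.
Qed.

(** * Maximal chains in a pure complex *)

Lemma nestedE x y : x != y -> nested x y = (x \subset y) || (y \subset x).
Proof.
by move=> ne; rewrite /nested !properEneq ne eq_sym ne.
Qed.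

Lemma sd_cliques K : sd K = cliques nested (above K set0).
Proof.
apply/setP=> C; rewrite inE.
apply/and3P/cliquesP=> [[/subsetP CK C0 /forall_inP ch]|[/subsetP CK ch]].
  split.
    by apply/subsetP=> s sC; rewrite inE CK // proper0; apply: contraNneq C0 => <-.
  move=> s t sC tC ne; rewrite nestedE //.
  by have /forall_inP := ch s sC; apply.
split.
- by apply/subsetP=> s /CK; rewrite inE => /andP[].
- by apply/negP=> /CK; rewrite inE properxx andbF.
apply/forall_inP=> s sC; apply/forall_inP=> t tC.
by case: (eqVneq s t) => [->|ne]; rewrite ?subxx // -nestedE // ch.
Qed.

(* The case of the empty chain covers chains starting above the empty face. *)
Lemma chain_bound (S : {set {set T}}) : {in S &, forall s t, s != t -> nested s t} ->
  exists2 a, (S = set0 /\ a = set0) \/ a \in S & forall c, c \in S -> c \subset a.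
Proof.
move=> ch; case: (set_0Vmem S) => [->|[a0 a0S]].
  by exists set0; [left|move=> c; rewrite inE].
have [a aS max_a] := @arg_maxnP _ a0 (mem S) (fun a => #|a|) a0S.
exists a; first by right.
move=> c cS; case: (eqVneq c a) => [->//|ne].
case/orP: (ch c a cS aS ne) => [/proper_sub //|/proper_card].
by move=> lt; have /= := max_a c cS; rewrite leqNgt lt.
Qed.

(** By purity a maximal chain has exactly one face of each cardinality from 1 to [#|F|]. *)
Lemma listing_above_size K F (s : seq {set T}) : is_complex K -> pure K -> F \in facets K ->
  listing nested (above K set0) s -> size s = #|F|.
Proof.
move=> cK pK FF ls; have FK : F \in K by move: FF; rewrite inE => /maxsetP[].
have us := listing_uniq nested_irr ls.
have sK z : z \in s -> z \in K /\ set0 \proper z.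
  by move=> /(listing_sub ls); rewrite inE => /andP.
have ch : {in s &, forall z t, z != t -> nested z t}.
  by move=> z t zs ts; have /cliquesP[_] := listing_clique nested_sym ls; apply; rewrite inE.
have max z : z \in K -> z != set0 -> (forall t, t \in s -> z != t -> nested z t) -> z \in s.
  move=> zK z0; apply: (listing_maximal nested_sym ls).
  by rewrite inE zK proper0.
(* Descent on cardinality: if [a] bounds the members strictly below [b], deleting from [b] a vertex
   outside [a] gives a face comparable with the whole chain, hence a member. *)
have dim m : m < #|F| -> exists2 b, b \in s & #|b| = #|F| - m.
  elim: m => [|m IH] lt.
    have [|a aS ub] := @chain_bound [set:: s].
      by move=> z t; rewrite !inE; apply: ch.
    have aK : a \in K.
      case: aS => [[_ ->]|]; first by apply: (cK F); rewrite ?sub0set.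
      by rewrite inE => /sK[].
    have [G GF aG] := facet_ex aK; have cG := pure_card pK GF FF.
    exists G; last by rewrite subn0.
    apply: max; first by move: GF; rewrite inE => /maxsetP[].
      by rewrite -card_gt0 cG.
    move=> t ts ne; rewrite nestedE // (subset_trans (ub t _) aG) ?orbT //.
    by rewrite inE.
  have [b bs cb] := IH (ltnW lt).
  have [|a aS ub] := @chain_bound [set z in s | z \proper b].
    by move=> z t; rewrite !inE => /andP[zs _] /andP[ts _]; apply: ch.
  have ab : a \proper b.
    case: aS => [[_ ->]|]; last by rewrite inE => /andP[].
    by have [] := sK b bs.
  have [_ [p pb pa]] := properP ab.
  have cbp : #|b :\ p| = #|F| - m.+1.
    by rewrite subnS -cb (cardsD1 p b) pb.
  exists (b :\ p) => //; apply: max.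
  - by have [bK _] := sK b bs; apply: cK bK (subsetDl _ _).
  - by rewrite -card_gt0 cbp subn_gt0.
  move=> t ts ne; rewrite nestedE //.
  case: (eqVneq t b) => [->|tb]; first by rewrite subsetDl.
  case/orP: (ch t b ts bs tb) => [tpb|/proper_sub bt];
    last by rewrite (subset_trans (subsetDl _ _) bt).
  have ta : t \subset a by apply: ub; rewrite inE ts.
  by rewrite subsetD1 (subset_trans ta (proper_sub ab)) (contra (subsetP ta p) pa) orbT.
have uc : uniq [seq #|z| | z : {set T} <- s].
  rewrite map_inj_in_uniq // => z t zs ts czt; apply/eqP; apply: contraT => ne.
  by case/orP: (ch z t zs ts ne) => /proper_card; rewrite czt ltnn.
have mem_c : [seq #|z| | z : {set T} <- s] =i iota 1 #|F|.
  move=> c; rewrite mem_iota; apply/mapP/andP=> [[z zs ->]|[c0 cF]].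
    have [zK z0] := sK z zs; rewrite card_gt0 -proper0 z0; split=> //.
    have [G GF zG] := facet_ex zK; rewrite add1n ltnS -(pure_card pK GF FF).
    exact: subset_leq_card.
  have [|b bs cb] := dim (#|F| - c).
    by rewrite ltn_subrL c0 (leq_trans c0).
  by exists b => //; rewrite cb subKn.
have := perm_size (uniq_perm uc (iota_uniq _ _) mem_c).
by rewrite size_map size_iota.
Qed.

End FacePosets.

Theorem theorem1 (T : finType) (K : {set {set T}}) (d : int) :
  is_complex K -> pure_of_dim K d -> HRC K -> shellable (sd (sd K)).
Proof.
move=> cK [pK [[s sK _] _]] hK.
have [F FF _] := facet_ex sK.
have K0 : set0 \in K by apply: cK sK (sub0set s).
rewrite (sd_cliques K); apply: (shelled_shellable (@nested_sym T) (@nested_irr T) (n := #|F|)).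
  by move=> t; apply: listing_above_size.
by have [] := HRC_ball cK pK hK K0.
Qed.
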